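(* Let $\lambda>0$ and assume that $0<p-1\le q$, $q\le 1$, and $\sigma\not\equiv 0$ on $\partial S$. Then every solution $u$ of the problem $$\begin{cases} u_t(x,t)=\Delta_{p,\omega}u(x,t)+\lambda|u(x,t)|^{q-1}u(x,t), & (x,t)\in S\times(0,\infty),\\ \mu(z)\frac{\partial u}{\partial_p n}(z,t)+\sigma(z)|u(z,t)|^{p-2}u(z,t)=0, & (z,t)\in\partial S\times[0,\infty),\\ u(x,0)=u_0(x)\ge 0, & x\in\overline S,\end{cases}$$ is global.
   Context: Network: $G=(V,E)$ is a finite, connected, simple graph with a weight $\omega:V\times V\to[0,\infty)$, i.e. $\omega(x,x)=0$, $\omega(x,y)=\omega(y,x)$, and $\omega(x,y)>0$ iff $x\sim y$ ($x,y$ adjacent). $S$ is a connected induced subgraph of $G$ (identified with its vertex set), $\partial S=\{z\in V\setminus S: y\sim z\text{ for some }y\in S\}$, and $\overline S=S\cup\partial S$ is the network whose edges are the edges of $G$ with at least one endpoint in $S$ (so there are no edges between two vertices of $\partial S$ in $\overline S$, and $\omega$ is regarded as $0$ there). Operators, for $u:\overline S\to\mathbb R$, with the convention $|a|^{p-2}a=0$ if $a=0$: $\Delta_{p,\omega}u(x)=\sum_{y\in\overline S}|u(x)-u(y)|^{p-2}[u(y)-u(x)]\omega(x,y)$ for $x\in\overline S$, and $\frac{\partial u}{\partial_p n}(z)=\sum_{y\in S}|u(z)-u(y)|^{p-2}[u(z)-u(y)]\omega(z,y)$ for $z\in\partial S$. For functions of $(x,t)$ they act in the variable $x$. Boundary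 coefficients: $\mu,\sigma:\partial S\to[0,\infty)$ with $\mu(z)+\sigma(z)>0$ for all $z\in\partial S$. Solution: a function $u$ on $\overline S\times[0,T)$, $0<T\le\infty$, with $u(x,\cdot)$ continuous on $[0,T)$ and differentiable in $(0,T)$ for each $x\in\overline S$, satisfying the problem for times in $[0,T)$, where $[0,T)$ is a maximal interval of existence. The solution is global if $T=\infty$. *)

(* Defs.v *)
From HB Require Import structures.
From mathcomp Require Import all_boot all_order all_algebra.
From mathcomp Require Import all_classical all_reals all_analysis.

Set Implicit Arguments.
Unset Strict Implicit.
Unset Printing Implicit Defensive.

Import Order.TTheory GRing.Theory Num.Theory.
Import numFieldNormedType.Exports.

Local Open Scope classical_set_scope.
Local Open Scope ring_scope.

Definition simple_graph (V : finType) (adj : rel V) : Prop :=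
  symmetric adj /\ irreflexive adj.

Definition induced_rel (V : finType) (adj : rel V) (A : {set V}) : rel V :=
  fun x y => [&& x \in A, y \in A & adj x y].

(* Connected graphs are nonempty by convention. *)
Definition connected_induced (V : finType) (adj : rel V) (A : {set V}) : Prop :=
  (exists x, x \in A) /\
  (forall x y, x \in A -> y \in A -> connect (induced_rel adj A) x y).

Definition connected_graph (V : finType) (adj : rel V) : Prop :=
  connected_induced adj [set: V]%SET.

Definition is_weight (R : realType) (V : finType) (adj : rel V)
    (w : V -> V -> R) : Prop :=
  [/\ forall x y, 0 <= w x y,
      forall x, w x x = 0,
      forall x y, w x y = w y x
    & forall x y, 0 < w x y <-> adj x y].

Definition bdry (V : finType) (adj : rel V) (S : {set V}) : {set V} :=
  [set z | (z \notin S) && [exists y, (y \in S) && adj y z]]%SET.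

Definition clos (V : finType) (adj : rel V) (S : {set V}) : {set V} :=
  (S :|: bdry adj S)%SET.

(* The weight of the network [clos adj S]: edges joining two boundary vertices
   are dropped. *)
Definition clos_weight (R : realType) (V : finType) (S : {set V})
    (w : V -> V -> R) (x y : V) : R :=
  if (x \in S) || (y \in S) then w x y else 0.

(* Functions on the closure of S are represented by functions on V, of which
   only the values on the closure are ever used.
   In [`|a| `^ r * b] below, with b = a or b = - a, the value at a = 0 is 0
   whatever r is, since b = 0 there (note that [0 `^ 0 = 1], so for p = 2 it is
   the factor b that vanishes). *)
Definition pLaplacian (R : realType) (V : finType) (adj : rel V) (S : {set V})
    (w : V -> V -> R) (p : R) (u : V -> R) (x : V) : R :=
  \sum_(y in clos adj S)
    `|u x - u y| `^ (p - 2) * (u y - u x) * clos_weight S w x y.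

Definition pnormal (R : realType) (V : finType) (S : {set V})
    (w : V -> V -> R) (p : R) (u : V -> R) (z : V) : R :=
  \sum_(y in S) `|u z - u y| `^ (p - 2) * (u z - u y) * clos_weight S w z y.

(* [u x t] is only constrained for x in the closure of S and t in [0, T). *)
Record solution_on (R : realType) (V : finType) (adj : rel V) (S : {set V})
    (w : V -> V -> R) (p q lambda : R) (mu sigma u0 : V -> R)
    (T : \bar R) (u : V -> R -> R) : Prop := SolutionOn {
  solution_continuous : forall x, x \in clos adj S ->
    {within [set t : R | 0 <= t /\ (t%:E < T)%E], continuous (u x)};
  solution_derivable : forall x, x \in clos adj S ->
    forall t : R, 0 < t -> (t%:E < T)%E -> derivable (u x) t 1;
  solution_equation : forall x, x \in S ->
    forall t : R, 0 < t -> (t%:E < T)%E ->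
      derive1 (u x) t = pLaplacian adj S w p (fun y => u y t) x
                    + lambda * `|u x t| `^ (q - 1) * u x t;
  solution_boundary : forall z, z \in bdry adj S ->
    forall t : R, 0 <= t -> (t%:E < T)%E ->
      mu z * pnormal S w p (fun y => u y t) z
      + sigma z * `|u z t| `^ (p - 2) * u z t = 0;
  solution_initial : forall x, x \in clos adj S -> u x 0 = u0 x
}.

(* A solution with maximal interval of existence [0, T), 0 < T <= +oo: no
   solution on a longer interval [0, T') extends u.  Maximality refers to the
   given u, because for exponents p - 1, q < 1 the nonlinearities are not
   Lipschitz and u0 alone need not determine the solution. *)
Definition solution (R : realType) (V : finType) (adj : rel V) (S : {set V})
    (w : V -> V -> R) (p q lambda : R) (mu sigma u0 : V -> R)
    (T : \bar R) (u : V -> R -> R) : Prop :=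
  [/\ (0 < T)%E,
      solution_on adj S w p q lambda mu sigma u0 T u
    & forall (T' : \bar R) (v : V -> R -> R),
        (T < T')%E ->
        solution_on adj S w p q lambda mu sigma u0 T' v ->
        ~ (forall x, x \in clos adj S ->
             forall t : R, 0 <= t -> (t%:E < T)%E -> v x t = u x t)].

(* Main.v *)
Require Import Defs.
From HB Require Import structures.
From mathcomp Require Import all_boot all_order all_algebra.
From mathcomp Require Import all_classical all_reals all_analysis.
From mathcomp Require Import ring lra.

Set Implicit Arguments.
Unset Strict Implicit.
Unset Printing Implicit Defensive.

Import Order.TTheory GRing.Theory Num.Theory.
Import numFieldNormedType.Exports.

Local Open Scope classical_set_scope.
Local Open Scope ring_scope.

(** A solution that lives only up to a finite time [T] can be continued past
[T], which contradicts maximality.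

The boundary condition at [z] says that a positive combination of the terms
[phi p (u z - u y)] and [phi p (u z)], with [phi p s = |s|^(p-2) s], vanishes.
Since [phi p] is continuous and strictly increasing, this determines [u z] from
the values of [u] on [S]; it is the [balance] point of those values.  The
problem thereby becomes an autonomous system on [S] with continuous right-hand
side [reduced_rhs], and three facts about it suffice.

(i) A solution is bounded on [0, T) ([a_priori_bound]).  A balance point is
bounded by the values that it balances, so at a point of [S] where [|u|] is
maximal the diffusion pushes [u] towards [0]; and where [|u| >= 1] the source is
at most [lambda |u|] because [q <= 1].  Hence [u^2 exp (- 4 lambda t)] cannot
reach a new maximum above [1] at a positive time.

(ii) A bounded solution has bounded speed on [S], so it has a limit [L] at [T];
its speed tends to [reduced_rhs L], which is then its left derivative at [T]
([left_state]).  As the exponents [p - 1] and [q] may be smaller than [1], the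
system is not Lipschitz, so the solution is restarted from [L] by Peano's
theorem ([peano]).  That theorem is obtained from Euler's polygons: their
pointwise limit along an ultrafilter inherits the estimates that make it a
solution.

(iii) A solution must also be differentiable in time at the boundary points,
where the implicit function theorem may fail because the derivative of [phi p]
is infinite at [0] when [p < 2].  It is at this place that [p <= 2], a
consequence of [p - 1 <= q <= 1], is used: if some terms of the balance vanish
at the given time, they dominate all the others, and being odd and homogeneous
they select one velocity, the same for both time directions
([balance_derivable]). *)


(** * The signed power nonlinearity *)

(** The nonlinearity of the p-Laplacian.  The source term is a multiple of
[phi (q + 1)]. *)
Definition phi (R : realType) (p s : R) : R := `|s| `^ (p - 2) * s.

Section Phi.
Context {R : realType}.
Implicit Types p s t d : R.

Lemma phi0 p : phi p 0 = 0.
Proof. by rewrite /phi mulr0. Qed.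

Lemma phiN p s : phi p (- s) = - phi p s.
Proof. by rewrite /phi normrN mulrN. Qed.

Lemma phiM p s t : phi p (s * t) = phi p s * phi p t.
Proof. by rewrite /phi normrM powRM// mulrACA. Qed.

Lemma phi2 s : phi 2 s = s.
Proof. by rewrite /phi subrr powRr0 mul1r. Qed.

Lemma phi_gt0 p s : 0 < s -> 0 < phi p s.
Proof. by move=> s0; rewrite /phi mulr_gt0// powR_gt0// normr_gt0 gt_eqF. Qed.

Lemma phi_powR p s : 1 < p -> 0 <= s -> phi p s = s `^ (p - 1).
Proof.
move=> p1 s0; rewrite /phi ger0_norm// mulrC.
have -> : p - 2 = (p - 1) - 1 by ring.
by rewrite mulr_powRB1// subr_gt0.
Qed.

Lemma phi_lt p s t : 1 < p -> s < t -> phi p s < phi p t.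
Proof.
move=> p1.
have pos a b : 0 <= a -> a < b -> phi p a < phi p b.
  move=> a0 ab; have b0 := le_lt_trans a0 ab.
  by rewrite !phi_powR ?(ltW b0)// gt0_ltr_powR ?nnegrE ?(ltW b0)// subr_gt0.
move=> st; have [s0|s0] := leP 0 s; first exact: pos.
have [t0|t0] := ltP 0 t.
  rewrite (@lt_trans _ _ 0) ?phi_gt0//.
  by rewrite -oppr_gt0 -phiN phi_gt0// oppr_gt0.
by rewrite -ltrN2 -!phiN pos ?oppr_ge0// ltrN2.
Qed.

Lemma phi_le p s t : 1 < p -> s <= t -> phi p s <= phi p t.
Proof.
move=> p1; rewrite le_eqVlt => /predU1P[->//|/(phi_lt p1)/ltW//].
Qed.

Lemma phi_ge0 p s : 0 <= s -> 0 <= phi p s.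
Proof. by move=> s0; rewrite /phi mulr_ge0// powR_ge0. Qed.

Lemma phi_le0 p s : s <= 0 -> phi p s <= 0.
Proof. by move=> s0; rewrite -oppr_ge0 -phiN phi_ge0// oppr_ge0. Qed.

Lemma norm_phi p s : `|phi p s| = phi p `|s|.
Proof. by rewrite /phi normrM normr_id ger0_norm// powR_ge0. Qed.

Lemma phi_derive p d : 1 < p -> d != 0 ->
  is_derive d 1 (phi p) ((p - 1) * `|d| `^ (p - 2)).
Proof.
move=> p1; have pos (x : R) : 0 < x -> is_derive x 1 (phi p) ((p - 1) * x `^ (p - 2)).
  move=> x0; have -> : p - 2 = (p - 1) - 1 by ring.
  apply: (@near_eq_is_derive _ _ _ (@powR R ^~ (p - 1))); last exact: is_derive1_powR.
    by near=> y; rewrite phi_powR// ltW//; near: y; exact: lt_nbhsr.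
rewrite neq_lt => /orP[d0|d0]; last by rewrite gtr0_norm//; exact: pos.
rewrite ltr0_norm//; have /pos h : 0 < - d by rewrite oppr_gt0.
have -> : phi p = - (phi p \o -%R) :> (R -> R).
  by apply/funext => x; rewrite fctE /= phiN opprK.
have dN : is_derive d 1 (-%R : R -> R) (- 1) by exact: is_deriveNid.
have hc := is_derive1_comp h dN.
by apply: (is_derive_eq (is_deriveN hc)); rewrite mulrN1 opprK.
Unshelve. all: by end_near. Qed.

(** Away from [0] the function is differentiable; at [0] it is small because
[|phi p s| = |s|^(p-1)] with a positive exponent. *)
Lemma phi_continuous p : 1 < p -> continuous (phi p).
Proof.
move=> p1 s; have [->|s0] := eqVneq s 0; last first.
  apply: differentiable_continuous; apply/derivable1_diffP.
  by case: (phi_derive p1 s0).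
rewrite /continuous_at phi0; apply/cvgrPdist_le => e e0.
have r0 : p - 1 != 0 by rewrite gt_eqF// subr_gt0.
have d0 : 0 < e `^ ((p - 1)^-1) by rewrite powR_gt0.
near=> x; rewrite sub0r normrN norm_phi phi_powR//.
have -> : e = e `^ ((p - 1)^-1) `^ (p - 1).
  by rewrite -powRrM mulVf// powRr1// ltW.
apply: ge0_ler_powR; rewrite ?nnegrE ?(ltW d0)//.
by rewrite subr_ge0 ltW.
Unshelve. all: by end_near. Qed.

Lemma cvg_phi {T : Type} {F : set_system T} {FF : Filter F} p (f : T -> R) (l : R) :
  1 < p -> f @ F --> l -> phi p (f x) @[x --> F] --> phi p l.
Proof. by move=> p1 fl; apply: continuous_cvg fl; exact: phi_continuous. Qed.

End Phi.

(** * Balance points of weighted sums of signed powers *)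

Section Balance.
Context {R : realType} {I : finType}.
Implicit Types (p a b : R) (c y : I -> R).

(** Weights for which a sum of increasing functions is strictly increasing. *)
Definition admissible c := (forall i, 0 <= c i) /\ (exists i, 0 < c i).

Definition flux p c y a : R := \sum_i c i * phi p (a - y i).

(** The default value is never reached for admissible weights and [1 < p], by
[balance_exists]. *)
Definition balance p c y : R := xget 0 [set a | flux p c y a = 0].

Lemma flux_gt0 p c y a : admissible c -> (forall i, 0 < c i -> y i < a) ->
  0 < flux p c y a.
Proof.
move=> [c0 [i ci]] ya; rewrite /flux (bigD1 i)//= ltr_wpDr//; last first.
  by rewrite mulr_gt0// phi_gt0// subr_gt0 ya.
apply: sumr_ge0 => j _; have := c0 j; rewrite le_eqVlt => /predU1P[<-|cj].
  by rewrite mul0r.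
by rewrite mulr_ge0// phi_ge0// subr_ge0 ltW// ya.
Qed.

Lemma fluxN p c y a : flux p c (fun i => - y i) (- a) = - flux p c y a.
Proof.
rewrite /flux -sumrN; apply: eq_bigr => i _.
by rewrite -mulrN -phiN opprB addrC opprK.
Qed.

Lemma flux_lt0 p c y a : admissible c -> (forall i, 0 < c i -> a < y i) ->
  flux p c y a < 0.
Proof.
move=> cP ya; rewrite -oppr_gt0 -fluxN flux_gt0// => i ci.
by rewrite ltrN2 ya.
Qed.

Lemma flux_lt p c y a b : 1 < p -> admissible c -> a < b ->
  flux p c y a < flux p c y b.
Proof.
move=> p1 [c0 [i ci]] ab; rewrite /flux (bigD1 i)//= [ltRHS](bigD1 i)//=.
apply: ltr_leD; first by rewrite ltr_pM2l// phi_lt// ltrD2r.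
by apply: ler_sum => j _; rewrite ler_wpM2l// phi_le// lerD2r ltW.
Qed.

(** Convergence of [Y] is asked only where the weight is positive, the other
terms being identically [0]. *)
Lemma cvg_flux {T : Type} {F : set_system T} {FF : Filter F} p c
    (Y : T -> I -> R) y (A : T -> R) a :
  1 < p -> (forall i, 0 < c i -> Y t i @[t --> F] --> y i) -> A t @[t --> F] --> a ->
  admissible c ->
  flux p c (Y t) (A t) @[t --> F] --> flux p c y a.
Proof.
move=> p1 Yy Aa [c0 _]; apply: cvg_big => [|i _]; first exact: add_continuous.
have := c0 i; rewrite le_eqVlt => /predU1P[<-|ci].
  under eq_fun do rewrite mul0r.
  by rewrite mul0r; exact: cvg_cst.
by apply: cvgMl_tmp; apply: cvg_phi => //; apply: cvgB => //; exact: Yy.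
Qed.

(** The flux is negative to the left of all the [y i] and positive to their
right. *)
Lemma balance_exists p c y : 1 < p -> admissible c ->
  exists a, flux p c y a = 0.
Proof.
move=> p1 cP; pose K := 1 + \sum_i `|y i|.
have yK i : `|y i| < K.
  by rewrite /K (bigD1 i)//= addrCA ltrDl ltr_wpDr// sumr_ge0.
have K0 : 0 <= K by rewrite addr_ge0// sumr_ge0.
have [|||a _ fa] := @IVT _ (flux p c y) (- K) K 0.
- by rewrite (@le_trans _ _ 0)// oppr_le0.
- apply: continuous_subspaceT => a.
  by apply: cvg_flux => // i _; exact: cvg_cst.
- rewrite ge_min le_max; apply/andP; split; apply/orP; [left|right].
    by apply/ltW/flux_lt0 => // i _; have := yK i; rewrite ltr_norml => /andP[].
  by apply/ltW/flux_gt0 => // i _; have := yK i; rewrite ltr_norml => /andP[].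
by exists a.
Qed.

Lemma balanceP p c y : 1 < p -> admissible c -> flux p c y (balance p c y) = 0.
Proof. by move=> p1 cP; exact: (xgetPex 0 (balance_exists y p1 cP)). Qed.

Lemma balance_gt p c y a : 1 < p -> admissible c -> flux p c y a < 0 ->
  a < balance p c y.
Proof.
move=> p1 cP fa; rewrite ltNge; apply/negP; rewrite le_eqVlt => /predU1P[ba|].
  by move: fa; rewrite -ba balanceP// ltxx.
by move=> /(flux_lt y p1 cP); rewrite balanceP// ltNge (ltW fa).
Qed.

Lemma balance_lt p c y a : 1 < p -> admissible c -> 0 < flux p c y a ->
  balance p c y < a.
Proof.
move=> p1 cP fa; rewrite ltNge; apply/negP; rewrite le_eqVlt => /predU1P[ba|].
  by move: fa; rewrite ba balanceP// ltxx.
by move=> /(flux_lt y p1 cP); rewrite balanceP// ltNge (ltW fa).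
Qed.

Lemma balance_unique p c y a : 1 < p -> admissible c -> flux p c y a = 0 ->
  a = balance p c y.
Proof.
move=> p1 cP fa; have := balanceP y p1 cP.
by case: (ltgtP a (balance p c y)) => // /(flux_lt y p1 cP); rewrite fa => + e;
  rewrite e ltxx.
Qed.

(** Outside [[-K, K]] all the differences in the flux have the same sign. *)
Lemma norm_balance_le p c y (K : R) : 1 < p -> admissible c ->
  (forall i, 0 < c i -> `|y i| <= K) -> `|balance p c y| <= K.
Proof.
move=> p1 cP yK; rewrite ler_norml !leNgt; apply/andP; split; apply/negP => h.
  suff : flux p c y (balance p c y) < 0 by rewrite balanceP// ltxx.
  apply: flux_lt0 => // i ci; apply: lt_le_trans h _.
  by have := yK i ci; rewrite ler_norml => /andP[].
suff : 0 < flux p c y (balance p c y) by rewrite balanceP// ltxx.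
apply: flux_gt0 => // i ci; apply: le_lt_trans h.
by have := yK i ci; rewrite ler_norml => /andP[].
Qed.

(** The flux of the limit has strict and opposite signs slightly to the left and
to the right of its balance point; these signs persist for nearby data, and
trap the balance point of these. *)
Lemma cvg_balance {T : Type} {F : set_system T} {FF : Filter F} p c
    (Y : T -> I -> R) y :
  1 < p -> admissible c -> (forall i, 0 < c i -> Y t i @[t --> F] --> y i) ->
  balance p c (Y t) @[t --> F] --> balance p c y.
Proof.
move=> p1 cP Yy; apply/cvgrPdist_lt => e e0.
have fp : 0 < flux p c y (balance p c y + e).
  by rewrite -(balanceP y p1 cP) flux_lt// ltrDl.
have fn : flux p c y (balance p c y - e) < 0.
  by rewrite -(balanceP y p1 cP) flux_lt// ltrBlDr ltrDl.
have cf a : flux p c (Y t) a @[t --> F] --> flux p c y a.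
  by apply: cvg_flux => //; exact: cvg_cst.
near=> t.
rewrite distrC ltr_distl; apply/andP; split.
- apply: balance_gt => //; near: t; exact: cvgr_lt (cf _) _ fn.
- apply: balance_lt => //; near: t; exact: cvgr_gt (cf _) _ fp.
Unshelve. all: by end_near. Qed.

End Balance.

(** * Differentiating a balance point along a curve *)

(** The function [x |-> (f (d + x) - f d) / x], extended by the derivative at
[0], is continuous at [0]; this avoids dividing by [s * K s], which may be [0]. *)
Lemma cvg_difference_quotient (R : realType) (f : R -> R) (d l : R) (K : R -> R) (k : R) :
  is_derive d 1 f l -> K s @[s --> 0^'] --> k ->
  (f (d + s * K s) - f d) / s @[s --> 0^'] --> l * k.
Proof.
move=> [df <-] Kk.
pose g x := if x == 0 then 'D_1 f d else (f (d + x) - f d) / x.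
have g0 : g x @[x --> 0] --> 'D_1 f d.
  apply/cvgrPdist_lt => e e0.
  have /cvgrPdist_lt/(_ e e0) : h^-1 *: (f (h *: 1 + d) - f d) @[h --> 0^'] --> 'D_1 f d.
    exact: df.
  rewrite !near_simpl near_withinE.
  apply: filterS => x xP; rewrite /g; case: eqP => [_|/eqP x0].
    by rewrite subrr normr0.
  by have := xP x0; rewrite /= /GRing.scale/= mulr1 (addrC d) [X in _ - X]mulrC.
have sK : s * K s @[s --> 0^'] --> 0.
  rewrite -[X in _ --> X](mul0r k); apply: cvgM => //.
  exact: nbhs_dnbhs.
apply: (@cvg_trans _ (g (s * K s) * K s @[s --> 0^'])).
  apply: near_eq_cvg; near=> s.
  have s0 : s != 0 by near: s; exact: nbhs_dnbhs_neq.
  rewrite /g mulf_eq0 (negbTE s0)/=; case: eqP => [->|/eqP K0].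
    by rewrite !mulr0 addr0 subrr mul0r.
  by field; rewrite s0.
by apply: cvgM => //; apply: cvg_comp sK _; exact: g0.
Unshelve. all: by end_near. Qed.

Section BalanceDerivable.
Context {R : realType} {I : finType}.
Implicit Types (p : R) (c e : I -> R).

(** Put the trial value [a + s * x] into the flux at time [t + s] and divide by
[N s].  The quotient tends to the flux, in [x], of the blown-up problem with
exponent [p'], weights [c i * e i] and data the derivatives of the [Y _ i].
The signs of this limit on the two sides of its balance point [b] confine the
difference quotients of the balance point of [Y] to a neighbourhood of [b], so
that [b] is the derivative. *)
Lemma balance_derivable_rescaled p p' c e (N : R -> R) (Y : R -> I -> R) (t : R) :
  1 < p -> 1 < p' -> admissible c -> admissible (fun i => c i * e i) ->
  (forall s, 0 < s -> 0 < N s) -> (forall s, s < 0 -> N s < 0) ->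
  (forall i, 0 < c i -> derivable (Y ^~ i) t 1) ->
  (forall i, 0 < c i -> forall (K : R -> R) (k : R), K s @[s --> 0^'] --> k ->
    let d := balance p c (Y t) - Y t i in
    (phi p (d + s * K s) - phi p d) / N s @[s --> 0^'] --> e i * phi p' k) ->
  derivable (fun r => balance p c (Y r)) t 1.
Proof.
move=> p1 p1' cP ceP Np Nn dY Ne.
pose h i := 'D_1 (Y ^~ i) t.
pose D i (s : R) := s^-1 * (Y (s + t) i - Y t i).
have Dh i : 0 < c i -> D i s @[s --> 0^'] --> h i.
  move=> /dY dYi; have : s^-1 *: (Y (s *: 1 + t) i - Y t i) @[s --> 0^'] --> h i by exact: dYi.
  by under eq_fun do rewrite /GRing.scale/= mulr1.
set a := balance p c (Y t) in Ne *; set b := balance p' (fun i => c i * e i) h.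
have G x : flux p c (Y (s + t)) (a + s * x) / N s @[s --> 0^'] -->
    flux p' (fun i => c i * e i) h x.
  apply: (@cvg_trans _ (\sum_i c i * ((phi p ((a - Y t i) + s * (x - D i s))
      - phi p (a - Y t i)) / N s) @[s --> 0^'])).
    apply: near_eq_cvg; near=> s.
    have s0 : s != 0 by near: s; exact: nbhs_dnbhs_neq.
    (* The subtracted terms add up to zero, because [a] balances [Y t]. *)
    transitivity (flux p c (Y (s + t)) (a + s * x) / N s - flux p c (Y t) a / N s);
      last by rewrite balanceP// mul0r subr0.
    rewrite /flux !mulr_suml -sumrB; apply: eq_bigr => i _.
    have -> : a - Y t i + s * (x - D i s) = a + s * x - Y (s + t) i.
      by rewrite /D; field.
    by rewrite mulrBl mulrBr !mulrA.
  apply: cvg_big => [|i _]; first exact: add_continuous.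
  have := cP.1 i; rewrite le_eqVlt => /predU1P[<-|ci].
    under eq_fun do rewrite mul0r.
    by rewrite !mul0r; exact: cvg_cst.
  rewrite -mulrA; apply: cvgMl_tmp; apply: (Ne i ci (fun s => x - D i s)).
  by apply: cvgB; [exact: cvg_cst|exact: Dh].
apply/cvg_ex; exists b; apply/cvgrPdist_lt => r r0.
have fp : 0 < flux p' (fun i => c i * e i) h (b + r).
  by rewrite -(balanceP h p1' ceP) flux_lt// ltrDl.
have fn : flux p' (fun i => c i * e i) h (b - r) < 0.
  by rewrite -(balanceP h p1' ceP) flux_lt// ltrBlDr ltrDl.
near=> s.
have s0 : s != 0 by near: s; exact: nbhs_dnbhs_neq.
have G1 : 0 < flux p c (Y (s + t)) (a + s * (b + r)) / N s.
  by near: s; exact: cvgr_gt (G _) _ fp.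
have G2 : flux p c (Y (s + t)) (a + s * (b - r)) / N s < 0.
  by near: s; exact: cvgr_lt (G _) _ fn.
rewrite /= /GRing.scale/= mulr1 -/a distrC ltr_distl.
move: s0; rewrite neq_lt => /orP[s0|s0].
- have Ns : (N s)^-1 < 0 by rewrite invr_lt0 Nn.
  rewrite nmulr_llt0// in G2; rewrite nmulr_lgt0// in G1.
  have := balance_gt p1 cP G1; have := balance_lt p1 cP G2.
  move=> B2 B1; rewrite mulrC ltr_ndivlMr// ltr_ndivrMr//.
  by apply/andP; split; lra.
- have Ns : 0 < (N s)^-1 by rewrite invr_gt0 Np.
  rewrite pmulr_llt0// in G2; rewrite pmulr_lgt0// in G1.
  have := balance_lt p1 cP G1; have := balance_gt p1 cP G2.
  move=> B2 B1; rewrite mulrC ltr_pdivlMr// ltr_pdivrMr//.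
  by apply/andP; split; lra.
Unshelve. all: by end_near. Qed.

(** There are two regimes.  If [p = 2] or if no term of the flux vanishes at time
[t], the flux is differentiable with positive derivative and the blow-up is
linear ([N s = s], [p' = 2]).  Otherwise [p < 2], and a vanishing term varies
like [phi p s], which dominates the variation of order [s] of the others:
dividing by [N s = phi p s], only the vanishing terms survive in the limit. *)
Lemma balance_derivable p c (Y : R -> I -> R) (t : R) :
  1 < p -> p <= 2 -> admissible c ->
  (forall i, 0 < c i -> derivable (Y ^~ i) t 1) ->
  derivable (fun r => balance p c (Y r)) t 1.
Proof.
move=> p1 p2 cP dY; pose d i := balance p c (Y t) - Y t i.
have [smooth|] := pselect (p = 2 \/ forall i, 0 < c i -> d i != 0).
  have phi' i : 0 < c i -> is_derive (d i) 1 (phi p) ((p - 1) * `|d i| `^ (p - 2)).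
    move=> ci; case: smooth => [->|/(_ i ci) di]; last exact: phi_derive.
    rewrite subrr powRr0 mulr1 (_ : 2 - 1 = 1); last by ring.
    have -> : phi 2 = id :> (R -> R) by apply/funext => x; rewrite phi2.
    exact: is_derive_id.
  apply: (@balance_derivable_rescaled p 2 c
    (fun i => (p - 1) * `|d i| `^ (p - 2)) id) => //.
  - by rewrite ltr1n.
  - split=> [i|]; first by rewrite mulr_ge0 ?cP.1// mulr_ge0 ?powR_ge0// subr_ge0 ltW.
    have [_ [i ci]] := cP; exists i; rewrite mulr_gt0// mulr_gt0 ?subr_gt0//.
    case: smooth => [->|/(_ i ci) di]; first by rewrite subrr powRr0.
    by rewrite powR_gt0// normr_gt0.
  - by move=> i ci K k Kk; rewrite phi2; exact: cvg_difference_quotient (phi' i ci) Kk.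
move=> /not_orP[/eqP pn2 /existsNP[i0 /not_implyP[ci0 /negP/negPn/eqP di0]]].
have {pn2} p2' : p < 2 by rewrite lt_neqAle pn2.
apply: (@balance_derivable_rescaled p p c (fun i => (d i == 0)%:R) (phi p)) => //.
- split=> [i|]; first by rewrite mulr_ge0 ?cP.1.
  by exists i0; rewrite di0 eqxx mulr1.
- by move=> s; exact: phi_gt0.
- by move=> s s0; rewrite -oppr_gt0 -phiN phi_gt0// oppr_gt0.
move=> i ci K k Kk; rewrite -/(d i); case: eqP => [->|/eqP di].
  rewrite mul1r; apply: (@cvg_trans _ (phi p (K s) @[s --> 0^'])); last exact: cvg_phi.
  apply: near_eq_cvg; near=> s.
  have s0 : s != 0 by near: s; exact: nbhs_dnbhs_neq.
  rewrite add0r phi0 subr0 phiM mulrAC divff ?mul1r//.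
  by rewrite -normr_gt0 norm_phi phi_gt0// normr_gt0.
(* [s / phi p s = |s|^(2-p)], which is [phi (3 - p) |s|]. *)
have s20 : phi (3 - p) `|s| @[s --> (0 : R)^'] --> 0.
  have n0 : `|s| @[s --> (0 : R)^'] --> `|(0 : R)|.
    by apply: cvg_trans (@norm_continuous _ R 0); apply: cvg_app; exact: nbhs_dnbhs.
  have p31 : 1 < 3 - p by lra.
  have := cvg_phi p31 n0; rewrite normr0 phi0; exact.
have := cvgM (cvg_difference_quotient (phi_derive p1 di) Kk) s20.
rewrite mul0r mulr0 => L.
apply: (@cvg_trans _ ((phi p (d i + s * K s) - phi p (d i)) / s * phi (3 - p) `|s|
    @[s --> 0^'])); last exact: L.
apply: near_eq_cvg; near=> s.
have s0 : s != 0 by near: s; exact: nbhs_dnbhs_neq.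
rewrite (@phi_powR _ (3 - p))//; last lra.
rewrite /phi invfM -mulrA; congr (_ * _); rewrite -powRN mulrC.
by congr (_ `^ _ / _); ring.
Unshelve. all: by end_near. Qed.

End BalanceDerivable.

(** * Existence for continuous bounded vector fields *)

(** Replaces the extraction of a subsequence by a choice that serves all times
and all coordinates at once. *)
Lemma ultra_bounded_cvg (R : realType) (T : Type) (G : set_system T) (g : T -> R) (K : R) :
  UltraFilter G -> (forall n, `|g n| <= K) -> exists l, g n @[n --> G] --> (l : R).
Proof.
move=> UG gK; have PG : ProperFilter G := ultra_proper.
have GK : (g @ G) `[- K, K]%classic.
  by apply: (@filterE _ G) => n; rewrite /= in_itv/= -ler_norml.
have [l [_ cl]] := @segment_compact R (- K) K _ _ GK.
exists l => B nB.
have [//|nGB] := in_ultra_setVsetC (g @^-1` B) UG.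
by have [z []] := cl (~` B) B nGB nB.
Qed.

(** Otherwise there are [Z n] within [1/(n+1)] of [y] whose images stay at
distance more than [e] from that of [y]. *)
Lemma eps_continuity_of_sequential (R : realType) (V : finType) (g : (V -> R) -> R) y :
  (forall Z : nat -> V -> R, (forall x, Z n x @[n --> \oo] --> y x) ->
     g (Z n) @[n --> \oo] --> g y) ->
  forall e, 0 < e -> exists2 d, 0 < d &
    forall y', (forall x, `|y' x - y x| <= d) -> `|g y' - g y| <= e.
Proof.
move=> gy e e0; apply: contrapT => nd.
have /choice[Z ZP] : forall n : nat, exists y' : V -> R,
    (forall x, `|y' x - y x| <= n.+1%:R^-1) /\ e < `|g y' - g y|.
  move=> n; apply: contrapT => ny; apply: nd; exists n.+1%:R^-1; first by rewrite invr_gt0.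
  by move=> y' yy'; rewrite leNgt; apply/negP => eg; apply: ny; exists y'.
have : g (Z n) @[n --> \oo] --> g y.
  apply: gy => x; apply/cvgrPdist_le => r r0.
  have /cvgrPdist_le/(_ r r0) := @cvg_harmonic R.
  apply: filterS => n; rewrite sub0r normrN ger0_norm ?invr_ge0// distrC.
  by apply: le_trans; have [] := ZP n.
move=> /cvgrPdist_le/(_ e e0)[N _ /(_ N (leqnn _))]; rewrite /= distrC leNgt.
by have [_ ->] := ZP N.
Qed.

Section Peano.
Context {R : realType} {V : finType}.
Variables (f : (V -> R) -> V -> R) (C : R) (y0 : V -> R).
Hypothesis fC : forall y x, `|f y x| <= C.

Definition euler n k : V -> R :=
  iter k (fun y x => y x + n.+1%:R^-1 * f y x) y0.

(** The Euler scheme of step [1/(n+1)] as a step function of time.  It is not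
interpolated: continuity is only needed in the limit. *)
Definition euler_at n (t : R) : V -> R := euler n (Num.truncn (t * n.+1%:R)).

(** The constant [v] stands for the vector field at a nearby limit point. *)
Lemma euler_increment n k j x v e :
  (forall i, (i < j)%N -> `|f (euler n (k + i)) x - v| <= e) ->
  `|euler n (k + j) x - euler n k x - j%:R / n.+1%:R * v| <= j%:R / n.+1%:R * e.
Proof.
elim: j => [_|j IH fe]; first by rewrite addn0 subrr !mul0r subrr normr0.
have -> : euler n (k + j.+1) x - euler n k x - j.+1%:R / n.+1%:R * v =
    (euler n (k + j) x - euler n k x - j%:R / n.+1%:R * v)
    + n.+1%:R^-1 * (f (euler n (k + j)) x - v).
  rewrite addnS [euler n (k + j).+1]/euler iterS -/(euler n (k + j)) -[j.+1]addn1 natrD.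
  by ring.
apply: (le_trans (ler_normD _ _)); rewrite -[j.+1]addn1 natrD !mulrDl mul1r lerD//.
  by apply: IH => i ij; apply: fe; rewrite ltnS ltnW.
by rewrite normrM ger0_norm ?invr_ge0// ler_wpM2l ?invr_ge0// fe.
Qed.

Lemma euler_lip n k j x : `|euler n (k + j) x - euler n k x| <= j%:R / n.+1%:R * C.
Proof.
have := @euler_increment n k j x 0 C; rewrite mulr0 subr0; apply => i _.
by rewrite subr0.
Qed.

(* Number of grid steps between two times. *)
Lemma grid_steps n (r t : R) : 0 <= r -> r <= t -> exists j,
  [/\ Num.truncn (t * n.+1%:R) = (Num.truncn (r * n.+1%:R) + j)%N
    & `|j%:R / n.+1%:R - (t - r)| <= n.+1%:R^-1].
Proof.
move=> r0 rt; have t0 := le_trans r0 rt.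
have N0 : 0 < n.+1%:R :> R by [].
have rN : 0 <= r * n.+1%:R by rewrite mulr_ge0.
have tN : 0 <= t * n.+1%:R by rewrite mulr_ge0.
have /andP[r1 r2] := truncn_itv rN; have /andP[t1 t2] := truncn_itv tN.
have le : (Num.truncn (r * n.+1%:R) <= Num.truncn (t * n.+1%:R))%N.
  by rewrite truncn_ge_nat// (le_trans r1)// ler_wpM2r.
exists (Num.truncn (t * n.+1%:R) - Num.truncn (r * n.+1%:R))%N.
split; first by rewrite subnKC.
rewrite natrB//.
have {}t2 : t * n.+1%:R < (Num.truncn (t * n.+1%:R))%:R + 1 by rewrite natr1.
have {}r2 : r * n.+1%:R < (Num.truncn (r * n.+1%:R))%:R + 1 by rewrite natr1.
set a := (Num.truncn (t * _))%:R in t1 t2 *; set b := (Num.truncn (r * _))%:R in r1 r2 *.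
rewrite -(ler_pM2r N0) mulVf ?gt_eqF// -[X in _ * X](gtr0_norm N0) -normrM.
have -> : ((a - b) / n.+1%:R - (t - r)) * n.+1%:R = (a - b) - (t * n.+1%:R - r * n.+1%:R).
  by rewrite mulrBl divfK ?gt_eqF// mulrBl.
by rewrite ler_norml; apply/andP; split; lra.
Qed.


Lemma euler_at_bound n t x : `|euler_at n t x - y0 x| <= `|t| * C.
Proof.
have C0 : 0 <= C by apply: le_trans (fC y0 x).
rewrite /euler_at; have [t0|t0] := leP 0 t; last first.
  rewrite (_ : Num.truncn _ = 0%N); first by rewrite subrr normr0 mulr_ge0.
  by apply/truncn0Pn; rewrite -ltNge (le_lt_trans _ ltr01)// mulr_le0_ge0// ltW.
have := euler_lip n 0 (Num.truncn (t * n.+1%:R)) x; rewrite add0n => /le_trans; apply.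
rewrite ler_wpM2r// ler_pdivrMr// ger0_norm// truncn_le.
by rewrite mulr_ge0.
Qed.

(** Near a limit point [Y t] the field is within [e] of [f (Y t)], hence so are
the slopes of the Euler scheme at all grid points between [a] and [b].  The
resulting two-point estimate involves only the values at [a], [b] and [t], so it
passes to a pointwise limit, without uniform convergence or integrals.  With
[a = t] or [b = t] it says that [Y] has the derivative [f (Y t)] at [t], one-sided
at [t = 0]. *)
Lemma peano :
  (forall (Z : nat -> V -> R) y x, (forall x, Z n x @[n --> \oo] --> y x) ->
    f (Z n) x @[n --> \oo] --> f y x) ->
  exists Y : R -> V -> R, (forall t x, `|Y t x - y0 x| <= `|t| * C) /\
    forall t x e, 0 <= t -> 0 < e -> exists2 d, 0 < d &
      forall a b, 0 <= a -> a <= t -> t <= b -> b - a < d ->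
        `|Y b x - Y a x - (b - a) * f (Y t) x| <= e * (b - a).
Proof.
move=> fcont.
have [G [UG sG]] := @ultraFilterLemma _ \oo%classic _.
have PG : ProperFilter G := @ultra_proper _ _ UG.
have Ylim t x : exists l : R, euler_at n t x @[n --> G] --> l.
  apply: (@ultra_bounded_cvg _ _ _ (fun n => euler_at n t x) (`|y0 x| + `|t| * C)) => // n.
  rewrite -(subrKC (y0 x) (euler_at n t x)) (le_trans (ler_normD _ _))//.
  by rewrite lerD2l euler_at_bound.
have {Ylim} [Y YP] : exists Y : R -> V -> R, forall t x,
    euler_at n t x @[n --> G] --> Y t x.
  exists (fun t x => xget 0 [set l | euler_at n t x @[n --> G] --> l]) => t x.
  exact: (xgetPex 0 (Ylim t x)).
exists Y; split=> [t x|].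
  have lim : `|euler_at n t x - y0 x| @[n --> G] --> `|Y t x - y0 x|.
    by apply: cvg_norm; apply: cvgB; [exact: YP|exact: cvg_cst].
  rewrite -(cvg_lim _ lim)//; apply: limr_le; first by apply/cvg_ex; exists `|Y t x - y0 x|.
  by apply: filterE => n; exact: euler_at_bound.
move=> t x e t0 e0; have [d d0 fd] := @eps_continuity_of_sequential _ _ (f ^~ x) (Y t)
  (fun Z ZY => fcont Z (Y t) x ZY) e e0.
have C0 : 0 <= C by apply: le_trans (fC y0 x).
have C1 : 0 < 4 * (C + 1) by rewrite mulr_gt0// ltr_wpDl.
(* The scheme moves by at most [C (b - a + 1/(n+1))], which is at most [d / 2]
   when both summands are below this bound; the other half of [d] covers the
   distance from the scheme to its limit. *)
exists (d / (4 * (C + 1))) => [|a b a0 at_ tb bad]; first by rewrite divr_gt0.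
have d'0 : 0 < d / (4 * (C + 1)) by rewrite divr_gt0.
apply/ler_addgt0Pr => eta eta0.
have tau0 (r : R) : 0 < r -> \forall n \near G, n.+1%:R^-1 <= r.
  move=> r0; apply: sG; have /cvgrPdist_le/(_ r r0) := @cvg_harmonic R.
  by apply: filterS => n; rewrite sub0r normrN ger0_norm// invr_ge0.
suff [n En] : exists n, [/\ `|Y b x - euler_at n b x| <= eta / 4,
   `|Y a x - euler_at n a x| <= eta / 4 &
   `|euler_at n b x - euler_at n a x - (b - a) * f (Y t) x| <= e * (b - a) + eta / 2].
  case: En; rewrite !ler_norml => /andP[b1 b2] /andP[a1 a2] /andP[c1 c2].
  by apply/andP; split; lra.
near G => n.
exists n; split.
- by near: n; move/cvgrPdist_le: (YP b x); apply; rewrite divr_gt0.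
- by near: n; move/cvgrPdist_le: (YP a x); apply; rewrite divr_gt0.
have tC : n.+1%:R^-1 <= d / (4 * (C + 1)) by near: n; exact: tau0.
have Ce0 : 0 < C + e by rewrite ltr_wpDl.
have te : n.+1%:R^-1 * (C + e) <= eta / 2.
  rewrite -ler_pdivlMr//; near: n; apply: tau0.
  by apply: divr_gt0; [exact: divr_gt0|rewrite ltr_wpDl].
have tY x' : `|Y t x' - euler_at n t x'| <= d / 2.
  move: x'; near: n; apply: filter_forall => x'.
  by move/cvgrPdist_le: (YP t x'); apply; rewrite divr_gt0.
have [i0 [tk _]] := @grid_steps n a t a0 at_.
have [i1 [bk _]] := @grid_steps n t b t0 tb.
have [j [bj jE]] := @grid_steps n a b a0 (le_trans at_ tb).
have ji : j = (i0 + i1)%N.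
  by apply/eqP; rewrite -(eqn_add2l (Num.truncn (a * n.+1%:R))) -bj bk tk addnA.
move: tY; rewrite /euler_at bj tk; set k := Num.truncn _ => tY.
set tau := n.+1%:R^-1 in tC te jE *.
have tau_ge0 : 0 <= tau by rewrite invr_ge0.
move: (jE); rewrite ler_norml => /andP[j1 j2].
have jC : j%:R * tau * C <= d / 2.
  have : j%:R * tau <= 2 * (d / (4 * (C + 1))) by lra.
  move=> /(ler_wpM2r C0)/le_trans; apply.
  have -> : 2 * (d / (4 * (C + 1))) * C = d / 2 * (C / (C + 1)).
    by field; rewrite gt_eqF// ltr_wpDl.
  by rewrite ler_piMr ?ler_pdivrMr ?mul1r ?ltr_wpDl// ?lerDl// ltW// divr_gt0.
have fe i : (i < j)%N -> `|f (euler n (k + i)) x - f (Y t) x| <= e.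
  move=> ij; apply: fd => x'.
  have : `|euler n (k + i) x' - euler n (k + i0) x'| <= d / 2.
    apply: le_trans jC; have [ii0|/ltnW ii0] := leqP i i0.
      rewrite distrC -(subnKC ii0) addnA (le_trans (euler_lip _ _ _ _))//.
      rewrite ler_wpM2r// ler_wpM2r// ler_nat ji.
      by rewrite (leq_trans (leq_subr _ _))// leq_addr.
    rewrite -(subnKC ii0) addnA (le_trans (euler_lip _ _ _ _))//.
    rewrite ler_wpM2r// ler_wpM2r// ler_nat.
    by rewrite (leq_trans (leq_subr _ _))// ltnW.
  have := tY x'; rewrite !ler_norml => /andP[c1 c2] /andP[c3 c4].
  by apply/andP; split; lra.
have := euler_increment fe; rewrite -/tau => inc.
have vC : `|(j%:R * tau - (b - a)) * f (Y t) x| <= tau * C.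
  by rewrite normrM ler_pM.
have je : j%:R * tau * e <= (b - a + tau) * e.
  by apply: ler_wpM2r; [exact: ltW|lra].
move: inc vC; rewrite !ler_norml => /andP[c1 c2] /andP[c3 c4].
by apply/andP; split; lra.
Unshelve. all: by end_near. Qed.

End Peano.

(** * Real functions near an endpoint *)

Section Calculus.
Context {R : realType}.
Implicit Types (g : R -> R) (a b e l r s t C : R).

(** The form in which the two sides of the restarting time are glued. *)
Lemma is_derive_sided g t l :
  (forall e, 0 < e -> exists2 d, 0 < d &
    forall s, t < s -> s - t < d -> `|g s - g t - (s - t) * l| <= e * (s - t)) ->
  (forall e, 0 < e -> exists2 d, 0 < d &
    forall s, s < t -> t - s < d -> `|g t - g s - (t - s) * l| <= e * (t - s)) ->
  is_derive t 1 g l.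
Proof.
move=> gr gl.
have gq : h^-1 *: (g (h *: 1 + t) - g t) @[h --> 0^'] --> l.
  apply/cvgrPdist_le => e e0.
  have [dr dr0 grd] := gr e e0; have [dl dl0 gld] := gl e e0.
  near=> h.
  have h0 : h != 0 by near: h; exact: nbhs_dnbhs_neq.
  have : `|h| < dr /\ `|h| < dl.
    by split; near: h; apply: nbhs_dnbhs;
      [exists dr|exists dl] => //= x; rewrite /ball/= sub0r normrN.
  rewrite /GRing.scale/= mulr1 => -[hr hl].
  have hgt0 : 0 < `|h| by rewrite normr_gt0.
  rewrite -(ler_pM2r hgt0) -normrM.
  have -> : (l - h^-1 * (g (h + t) - g t)) * h = - (g (h + t) - g t - h * l) by field.
  rewrite normrN; move: h0; rewrite neq_lt => /orP[h0|h0].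
    have ht : h + t < t by rewrite gtrDr.
    have hE : t - (h + t) = `|h| by rewrite ltr0_norm//; ring.
    have := gld _ ht; rewrite hE => /(_ hl); apply: le_trans.
    by rewrite (ltr0_norm h0) -normrN le_eqVlt; apply/orP; left; apply/eqP; congr `|_|; ring.
  have ht : t < h + t by rewrite ltrDr.
  have hE : h + t - t = `|h| by rewrite gtr0_norm//; ring.
  by have := grd _ ht; rewrite hE => /(_ hr); rewrite (gtr0_norm h0).
have dg : derivable g t 1 by apply/cvg_ex; exists l.
by apply: (DeriveDef dg); exact: cvg_lim gq.
Unshelve. all: by end_near. Qed.

Lemma mean_value_le g a b l e :
  (forall t, a < t -> t < b -> derivable g t 1) ->
  (forall t, a < t -> t < b -> `|derive1 g t - l| <= e) ->
  forall s t, a < s -> s <= t -> t < b -> `|g t - g s - (t - s) * l| <= e * (t - s).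
Proof.
move=> dg ge s t as_ st tb.
have [||c] := @MVT_segment R g (derive1 g) s t st.
- move=> x; rewrite in_itv/= => /andP[sx xt]; rewrite derive1E.
  by apply/derivableP/dg; [exact: lt_trans sx|exact: lt_trans tb].
- apply: derivable_within_continuous => x; rewrite in_itv/= => /andP[sx xt].
  by apply: dg; [exact: lt_le_trans sx|exact: le_lt_trans tb].
rewrite in_itv/= => /andP[sc ct] ->.
have ts : 0 <= t - s by rewrite subr_ge0.
have -> : derive1 g c * (t - s) - (t - s) * l = (derive1 g c - l) * (t - s) by ring.
rewrite normrM (ger0_norm ts); apply: ler_wpM2r => //.
by apply: ge; [exact: lt_le_trans sc|exact: le_lt_trans tb].
Qed.

(** The functions [g s - C (b - s)] and [g s + C (b - s)] are respectively
nondecreasing and nonincreasing, and the limit is the supremum of the first. *)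
Lemma lipschitz_left_limit g a b C : a < b ->
  (forall s t, a < s -> s <= t -> t < b -> `|g t - g s| <= C * (t - s)) ->
  exists l, forall s, a < s -> s < b -> `|l - g s| <= C * (b - s).
Proof.
move=> ab gC.
have C0 : 0 <= C.
  have [m /andP[am mb]] : exists m, a < m < b by exists ((a + b) / 2); rewrite !midf_lt.
  have [n /andP[mn nb]] : exists n, m < n < b by exists ((m + b) / 2); rewrite !midf_lt.
  have := gC m n am (ltW mn) nb; have := normr_ge0 (g n - g m) => n0 /(le_trans n0).
  by rewrite pmulr_lge0// subr_gt0.
have Cge0 s : a < s -> s < b -> 0 <= C * (b - s).
  by move=> _ sb; rewrite mulr_ge0// subr_ge0 ltW.
pose A := [set g s - C * (b - s) | s in [set s | a < s < b]].
have Aub s : a < s -> s < b -> ubound A (g s + C * (b - s)).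
  move=> as_ sb _ [r /= /andP[ar rb] <-].
  have [sr|/ltW rs] := leP s r.
    have := gC s r as_ sr rb; rewrite ler_norml => /andP[_].
    have := Cge0 _ ar rb; have -> : C * (r - s) = C * (b - s) - C * (b - r) by ring.
    by lra.
  have := gC r s ar rs sb; rewrite ler_norml => /andP[+ _].
  have := Cge0 _ as_ sb; have -> : C * (s - r) = C * (b - r) - C * (b - s) by ring.
  by lra.
exists (sup A) => s as_ sb; rewrite ler_norml; apply/andP; split.
- rewrite lerBrDr addrC; apply: ub_le_sup; first by exists (g s + C * (b - s)); exact: Aub.
  by exists s => //=; rewrite as_.
- rewrite lerBlDl; apply: ge_sup; last exact: Aub.
  by exists (g s - C * (b - s)); exists s => //=; rewrite as_.
Qed.

(** One-sided, since the maximum over a time interval may be reached at its right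
end. *)
Lemma derive1_ge0_left_max g a t : a < t -> derivable g t 1 ->
  (forall s, a < s -> s < t -> g s <= g t) -> 0 <= derive1 g t.
Proof.
move=> at_ dg gt; rewrite derive1E.
rewrite ['D_1 g t]cvg_at_leftE; last exact: dg.
apply: limr_ge.
  rewrite -(cvg_at_leftE (fun h => h^-1 *: ((g \o shift t) _ - g t))) //.
  apply: cvg_trans dg; apply: cvg_app.
  move=> A [e egt0 Ae]; exists e => // x xe xgt0; apply: Ae => //.
  exact/ltr0_neq0.
near=> h; apply: mulr_le0.
  by rewrite invr_le0; apply: ltW; near: h; exists 1 => /=.
rewrite subr_le0 [_%:A]mulr1; apply: gt; near: h.
  exists (t - a); first by rewrite /= subr_gt0.
  move=> h; rewrite /= distrC subr0 => /ltr_normlP [] + _ _.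
  by rewrite ltrBrDl addrC -ltrBlDr; rewrite /=; lra.
exists 1 => //= h _ h0.
by rewrite gtrDr.
Unshelve. all: by end_near. Qed.

End Calculus.

(** * Elimination of the boundary values *)

Section Network.
Context {R : realType} {V : finType}.
Variables (adj : rel V) (w : V -> V -> R) (S : {set V}) (p q lambda : R).
Variables (mu sigma : V -> R).
Implicit Types (y u : V -> R) (x z : V).

(** The weights of the boundary condition at [z], seen as a balance of the values
on [S] and of the value [0].  As [z] lies outside [S], its own index is free and
is used for the term in [sigma z]; accordingly [inner y z = 0]. *)
Definition bdry_coef z x : R :=
  if x == z then sigma z else if x \in S then mu z * w z x else 0.

Definition inner y x : R := if x \in S then y x else 0.

Definition bdry_extend y x : R := if x \in S then y x else balance p (bdry_coef x) (inner y).

(** The right-hand side of the equation after the boundary values have been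
expressed by those on [S]. *)
Definition reduced_rhs y x : R :=
  if x \in S then pLaplacian adj S w p (bdry_extend y) x + lambda * phi (q + 1) (y x) else 0.

Lemma boundary_flux z u : z \notin S ->
  mu z * pnormal S w p u z + sigma z * `|u z| `^ (p - 2) * u z =
  flux p (bdry_coef z) (inner u) (u z).
Proof.
move=> zS; rewrite /flux (bigD1 z)//= addrC /bdry_coef /inner eqxx (negbTE zS) subr0 -mulrA.
congr (_ + _); rewrite /pnormal mulr_sumr big_mkcond [RHS]big_mkcond/=.
apply: eq_bigr => x _; case: ifPn => [xS|xS].
  have xz : x != z by apply: contraNneq zS => <-.
  by rewrite xz (negbTE xz) /clos_weight xS orbT /phi; ring.
by case: eqP => //= _; rewrite mul0r.
Qed.

Lemma eq_inner y y' : {in S, y =1 y'} -> inner y = inner y'.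
Proof. by move=> yy; apply/funext => x; rewrite /inner; case: ifPn => // /yy. Qed.

Lemma eq_extend y y' : {in S, y =1 y'} -> bdry_extend y = bdry_extend y'.
Proof.
move=> yy; apply/funext => x; rewrite /bdry_extend (eq_inner yy).
by case: ifPn => // /yy.
Qed.

Lemma eq_rhs y y' : {in S, y =1 y'} -> reduced_rhs y = reduced_rhs y'.
Proof.
move=> yy; apply/funext => x; rewrite /reduced_rhs (eq_extend yy).
by case: ifPn => // /yy ->.
Qed.

Lemma pLaplacianE u x :
  pLaplacian adj S w p u x = \sum_(y in clos adj S) clos_weight S w x y * phi p (u y - u x).
Proof. by apply: eq_bigr => y _; rewrite /phi distrC mulrC. Qed.

Lemma eq_pLaplacian u u' x : x \in clos adj S -> {in clos adj S, u =1 u'} ->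
  pLaplacian adj S w p u x = pLaplacian adj S w p u' x.
Proof. by move=> xS uu; apply: eq_bigr => y yS; rewrite !uu. Qed.

Hypothesis hw : is_weight adj w.
Hypothesis hmu : forall z, z \in bdry adj S -> 0 <= mu z.
Hypothesis hsigma : forall z, z \in bdry adj S -> 0 <= sigma z.
Hypothesis hmusigma : forall z, z \in bdry adj S -> 0 < mu z + sigma z.
Hypothesis p1 : 1 < p.

Lemma bdry_notin z : z \in bdry adj S -> z \notin S.
Proof. by rewrite inE => /andP[]. Qed.

Lemma clos_cases x : x \in clos adj S -> (x \in S) \/ (x \in bdry adj S).
Proof. by rewrite finset.in_setU => /orP. Qed.

Lemma sub_clos x : x \in S -> x \in clos adj S.
Proof. by move=> xS; rewrite finset.in_setU xS. Qed.

Lemma clos_weight_ge0 x z : 0 <= clos_weight S w x z.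
Proof. by case: hw => w0 _ _ _; rewrite /clos_weight; case: ifP. Qed.

(** If [mu z = 0] then [sigma z > 0]; if [mu z > 0], a neighbour of [z] in [S]
has positive weight. *)
Lemma bdry_coef_admissible z : z \in bdry adj S -> admissible (bdry_coef z).
Proof.
case: hw => w0 _ wsym wadj zb; split=> [x|].
  rewrite /bdry_coef; case: ifP => _; first exact: hsigma.
  by case: ifP => _ //; rewrite mulr_ge0// hmu.
have [mu0|mu0] := eqVneq (mu z) 0.
  by exists z; rewrite /bdry_coef eqxx; have := hmusigma zb; rewrite mu0 add0r.
have zS := bdry_notin zb; move: (zb); rewrite inE zS => /existsP[x /andP[xS xz]].
exists x; rewrite /bdry_coef xS ifN; last by apply: contraNneq zS => <-.
apply: mulr_gt0; first by rewrite lt_def mu0 hmu.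
by rewrite wsym; apply/wadj.
Qed.

(** The boundary condition leaves no freedom in the boundary values. *)
Lemma eq_bdry_extend u :
  (forall z, z \in bdry adj S ->
    mu z * pnormal S w p u z + sigma z * `|u z| `^ (p - 2) * u z = 0) ->
  {in clos adj S, u =1 bdry_extend u}.
Proof.
move=> ub x /clos_cases[xS|xb]; first by rewrite /bdry_extend xS.
rewrite /bdry_extend (negbTE (bdry_notin xb)); apply: balance_unique => //.
  exact: bdry_coef_admissible.
by rewrite -boundary_flux ?ub// bdry_notin.
Qed.

Lemma bdry_extend_boundary y z : z \in bdry adj S ->
  mu z * pnormal S w p (bdry_extend y) z
    + sigma z * `|bdry_extend y z| `^ (p - 2) * bdry_extend y z = 0.
Proof.
move=> zb; rewrite boundary_flux ?bdry_notin//.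
rewrite (_ : inner (bdry_extend y) = inner y); last first.
  by apply: eq_inner => x xS; rewrite /bdry_extend xS.
by rewrite /bdry_extend (negbTE (bdry_notin zb)) balanceP//; exact: bdry_coef_admissible.
Qed.

(** The maximum principle for the boundary condition. *)
Lemma norm_extend_le y (K : R) : 0 <= K -> (forall x, x \in S -> `|y x| <= K) ->
  forall x, x \in clos adj S -> `|bdry_extend y x| <= K.
Proof.
move=> K0 yK x /clos_cases[xS|xb]; first by rewrite /bdry_extend xS yK.
rewrite /bdry_extend (negbTE (bdry_notin xb)); apply: norm_balance_le => //.
  exact: bdry_coef_admissible.
by move=> i _; rewrite /inner; case: ifP => [/yK//|]; rewrite normr0.
Qed.

Lemma cvg_extend (T : Type) (F : set_system T) {FF : Filter F} (Y : T -> V -> R) y x :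
  (forall x, x \in S -> Y t x @[t --> F] --> y x) -> x \in clos adj S ->
  bdry_extend (Y t) x @[t --> F] --> bdry_extend y x.
Proof.
move=> Yy /clos_cases[xS|xb]; rewrite /bdry_extend.
  by rewrite xS; exact: Yy.
rewrite (negbTE (bdry_notin xb)); apply: cvg_balance => //.
  exact: bdry_coef_admissible.
by move=> i _; rewrite /inner; case: ifP => [/Yy//|_]; exact: cvg_cst.
Qed.

Hypothesis q0 : 0 < q.

Lemma cvg_rhs (T : Type) (F : set_system T) {FF : Filter F} (Y : T -> V -> R) y x :
  (forall x, x \in S -> Y t x @[t --> F] --> y x) ->
  reduced_rhs (Y t) x @[t --> F] --> reduced_rhs y x.
Proof.
move=> Yy; rewrite /reduced_rhs; case: ifPn => xS; last exact: cvg_cst.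
have q1 : 1 < q + 1 by rewrite ltrDr.
apply: cvgD; last by apply: cvgMl_tmp; apply: cvg_phi => //; exact: Yy.
under eq_fun do rewrite pLaplacianE; rewrite pLaplacianE.
apply: cvg_big => [|z zS]; first exact: add_continuous.
apply: cvgMl_tmp; apply: cvg_phi => //.
by apply: cvgB; apply: cvg_extend => //; exact: sub_clos.
Qed.

Hypothesis lambda0 : 0 < lambda.

Lemma rhs_bounded (K : R) : 0 <= K -> exists M, forall y x,
  (forall x, x \in S -> `|y x| <= K) -> `|reduced_rhs y x| <= M.
Proof.
move=> K0; have q1 : 1 < q + 1 by rewrite ltrDr.
pose m x := \sum_(z in clos adj S) clos_weight S w x z * phi p (K + K).
have m0 x : 0 <= m x.
  by apply: sumr_ge0 => z _; rewrite mulr_ge0 ?clos_weight_ge0// phi_ge0// addr_ge0.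
have Q0 : 0 <= lambda * phi (q + 1) K by rewrite mulr_ge0 ?phi_ge0// ltW.
exists (\sum_x m x + lambda * phi (q + 1) K) => y x yK.
rewrite /reduced_rhs; case: ifPn => xS; last by rewrite normr0 addr_ge0// sumr_ge0.
rewrite (le_trans (ler_normD _ _))// lerD//; last first.
  by rewrite normrM norm_phi gtr0_norm// ler_wpM2l ?(ltW lambda0)// phi_le// yK.
rewrite (@le_trans _ _ (m x))//; last by rewrite (bigD1 x)//= lerDl sumr_ge0.
rewrite pLaplacianE (le_trans (ler_norm_sum _ _ _))//; apply: ler_sum => z zS.
rewrite normrM norm_phi ger0_norm ?clos_weight_ge0// ler_wpM2l ?clos_weight_ge0//.
apply: phi_le => //; rewrite (le_trans (ler_normB _ _))// lerD//.
  exact: norm_extend_le.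
by apply: norm_extend_le => //; exact: sub_clos.
Qed.

(** At a maximum of [|y|] on [S] all the diffusion terms have the sign opposite
to [y x], by [norm_extend_le] for those coming from the boundary.  For the source,
[|y x|^q <= |y x|] since [q <= 1 <= |y x|]. *)
Lemma rhs_at_max y x : q <= 1 -> x \in S -> 1 <= `|y x| ->
  (forall z, z \in S -> `|y z| <= `|y x|) -> y x * reduced_rhs y x <= lambda * y x ^+ 2.
Proof.
move=> qle1 xS yx1 ymax; rewrite /reduced_rhs xS mulrDr pLaplacianE mulr_sumr.
rewrite -[leRHS]add0r lerD//.
  apply: sumr_le0 => z zS; rewrite mulrCA mulr_ge0_le0 ?clos_weight_ge0//.
  have := norm_extend_le (normr_ge0 (y x)) ymax zS.
  rewrite {2 3}/bdry_extend xS; have [yx0|yx0] := leP 0 (y x).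
    rewrite (ger0_norm yx0) ler_norml => /andP[_ zx].
    by rewrite mulr_ge0_le0// phi_le0// subr_le0.
  rewrite (ltr0_norm yx0) ler_norml opprK => /andP[zx _].
  by rewrite mulr_le0_ge0 ?(ltW yx0)// phi_ge0// subr_ge0.
rewrite mulrCA ler_wpM2l ?(ltW lambda0)// expr2.
have -> : y x * phi (q + 1) (y x) = `|y x| * (`|y x| * `|y x| `^ (q - 1)).
  rewrite /phi (_ : q + 1 - 2 = q - 1); last by ring.
  have yy : y x * y x = `|y x| * `|y x| by rewrite -normrM ger0_norm// -expr2 sqr_ge0.
  by rewrite mulrCA yy; ring.
rewrite mulr_powRB1// -[leRHS]ger0_norm -?expr2 ?sqr_ge0// normrX expr2.
by rewrite ler_wpM2l// ler1_powR.
Qed.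

End Network.

(** * A priori bound and continuation of solutions *)

Section Solution.
Context {R : realType} {V : finType}.
Variables (adj : rel V) (w : V -> V -> R) (S : {set V}) (p q lambda : R).
Variables (mu sigma : V -> R).

Hypothesis hw : is_weight adj w.
Hypothesis hmu : forall z, z \in bdry adj S -> 0 <= mu z.
Hypothesis hsigma : forall z, z \in bdry adj S -> 0 <= sigma z.
Hypothesis hmusigma : forall z, z \in bdry adj S -> 0 < mu z + sigma z.
Hypothesis p1 : 1 < p.
Hypothesis q0 : 0 < q.
Hypothesis lambda0 : 0 < lambda.

Local Notation rhs := (reduced_rhs adj w S p q lambda mu sigma).
Local Notation extend := (bdry_extend w S p mu sigma).

Variables (u0 : V -> R) (T : R) (u : V -> R -> R).
Hypothesis T0 : 0 < T.
Hypothesis hu : solution_on adj S w p q lambda mu sigma u0 T%:E u.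

Lemma solution_extend t x : 0 <= t -> t < T -> x \in clos adj S ->
  u x t = extend (fun x => u x t) x.
Proof.
move=> t0 tT; apply: (@eq_bdry_extend _ _ adj w S p mu sigma) => // z zb.
by apply: (solution_boundary hu); rewrite ?lte_fin.
Qed.

Lemma solution_rhs t x : 0 < t -> t < T -> x \in S ->
  is_derive t 1 (u x) (rhs (fun x => u x t) x).
Proof.
move=> t0 tT xS; have du : derivable (u x) t 1.
  by apply: (solution_derivable hu); rewrite ?lte_fin//; exact: sub_clos.
apply: (DeriveDef du); rewrite -derive1E (solution_equation hu) ?lte_fin// /reduced_rhs xS.
congr (_ + _); last by rewrite /phi -mulrA; congr (_ * (_ `^ _ * _)); ring.
apply: eq_pLaplacian; first exact: sub_clos.
by move=> z zS; apply: solution_extend => //; exact: ltW.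
Qed.

Lemma solution_within_continuous x : x \in clos adj S ->
  {within [set t : R | 0 <= t < T], continuous (u x)}.
Proof.
move=> xS; have := solution_continuous hu xS.
rewrite (_ : [set t : R | 0 <= t /\ (t%:E < T%:E)%E] = [set t : R | 0 <= t < T])//.
by apply/seteqP; split=> t /=; rewrite lte_fin => /andP.
Qed.

Let weight (t : R) : R := expR (- (4 * lambda * t)).
Let h x (t : R) : R := u x t * u x t * weight t.

(** The rate [4 lambda] exceeds the growth rate [2 lambda] of [u^2] at a large
maximum given by [rhs_at_max]. *)
Lemma weighted_square_derive t x : 0 < t -> t < T -> x \in S ->
  is_derive t 1 (h x)
    (2 * (u x t * rhs (fun x => u x t) x - 2 * lambda * u x t ^+ 2) * weight t).
Proof.
move=> t0 tT xS; have du := solution_rhs t0 tT xS.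
have dl : is_derive t 1 (fun s : R => - (4 * lambda * s)) (- (4 * lambda)).
  have := is_deriveN (is_deriveZ (4 * lambda) (is_derive_id t (1 : R))).
  by rewrite /GRing.scale/= mulr1.
have dw := @is_derive1_comp _ expR (fun s : R => - (4 * lambda * s)) t _ _
    (is_derive_expR _) dl.
have dh := is_deriveM (is_deriveM du du) dw.
apply: (is_derive_eq (f := h x) dh).
rewrite /GRing.scale/= /weight.
have -> : (u x * u x) t = u x t * u x t by [].
by ring.
Qed.

(** Maximize [h y s] over [y] in [S] and [s] in [[0, t1]].  If the maximum is
reached at a positive time, the derivative of [h] is nonnegative there, which by
[rhs_at_max] forces [|u| < 1]; otherwise it is an initial value. *)
Lemma a_priori_bound : q <= 1 -> (exists x, x \in S) ->
  exists K, forall x t, x \in S -> 0 <= t -> t < T -> `|u x t| <= K.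
Proof.
move=> q1 [x0 x0S].
pose A := (1 + \sum_x u x 0 * u x 0).
have A1 : 1 <= A by rewrite lerDl sumr_ge0// => x _; rewrite -expr2 sqr_ge0.
exists (A * expR (4 * lambda * T) + 1) => x t1 xS t10 t1T.
have hcont z : z \in S -> {within `[0, t1], continuous (h z)}.
  move=> zS; have uc : {within `[0, t1], continuous (u z)}.
    apply: continuous_subspaceW (solution_within_continuous (sub_clos adj zS)).
    by move=> s /=; rewrite in_itv/= => /andP[-> /le_lt_trans ->].
  have wc : {within `[0, t1], continuous weight}.
    apply: continuous_subspaceT => s; apply: continuous_comp; last exact: continuous_expR.
    by apply: cvgN; apply: cvgMl_tmp; exact: cvg_id.
  by move=> s; apply: cvgM; [apply: cvgM; exact: uc|exact: wc].
have /choice[tau tauP] : forall z, exists s, z \in S ->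
    s \in `[0, t1] /\ forall r, r \in `[0, t1] -> h z r <= h z s.
  move=> z; have [zS|zS] := boolP (z \in S); last by exists 0.
  by have [s s1 s2] := EVT_max t10 (hcont z zS); exists s.
pose y := [arg max_(z > x0 in S) h z (tau z)]%O.
have [yS ymax] : y \in S /\ forall z, z \in S -> h z (tau z) <= h y (tau y).
  by rewrite /y; case: arg_maxP => // z zS zmax.
have wpos s : 0 < weight s by exact: expR_gt0.
have hA : h y (tau y) <= A.
  have [] := tauP y yS; rewrite in_itv/= => /andP[].
  rewrite le_eqVlt => /predU1P[<- _ _|tau0 taut1 hy].
    rewrite /h /weight mulr0 oppr0 expR0 mulr1 /A (bigD1 y)//= addrCA lerDl.
    by rewrite addr_ge0// sumr_ge0// => z _; rewrite -expr2 sqr_ge0.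
  have tauT : tau y < T by exact: le_lt_trans t1T.
  have tauI : tau y \in `[0, t1] by rewrite in_itv/= (ltW tau0).
  have dh := weighted_square_derive tau0 tauT yS.
  have : 0 <= derive1 (h y) (tau y).
    apply: (@derive1_ge0_left_max _ _ 0) => // s s0 st.
    by apply: hy; rewrite in_itv/= (ltW s0) (le_trans (ltW st)).
  rewrite derive1E (@derive_val _ _ _ _ _ _ _ dh) pmulr_lge0// pmulr_rge0// => dpos.
  have [uy1|uy1] := leP 1 `|u y (tau y)|; last first.
    apply: le_trans A1; rewrite /h mulr_ile1 ?(ltW (wpos _))//.
    - by rewrite -expr2 sqr_ge0.
    - by move: uy1; rewrite ltr_norml => /andP[? ?]; nra.
    by rewrite /weight -expR0 ler_expR oppr_le0 !mulr_ge0// ltW.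
  have ycmp z : z \in S -> `|u z (tau y)| <= `|u y (tau y)|.
    move=> zS; have := ymax z zS; have [_ /(_ _ tauI) hz] := tauP z zS.
    move=> /(le_trans hz); rewrite /h ler_pM2r// -!expr2 => le2.
    by rewrite -ler_sqr ?nnegrE// !real_normK ?num_real.
  have := @rhs_at_max _ _ adj w S p q lambda mu sigma hw hmu hsigma hmusigma p1 q0 lambda0
    (fun x => u x (tau y)) y q1 yS uy1 ycmp.
  move=> le1.
  have u2 : u y (tau y) ^+ 2 <= 0.
    by rewrite -(pmulr_rle0 _ lambda0); lra.
  apply: le_trans (le_trans ler01 A1); rewrite /h -expr2.
  by rewrite pmulr_lle0.
have t1I : t1 \in `[0, t1] by rewrite in_itv/= t10 lexx.
have [_ /(_ _ t1I) hx] := tauP x xS.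
have := le_trans hx (le_trans (ymax x xS) hA).
rewrite /h /weight expRN ler_pdivrMr ?expR_gt0// => ux.
have : `|u x t1| * `|u x t1| <= A * expR (4 * lambda * T).
  rewrite -normrM ger0_norm -?expr2 ?sqr_ge0// expr2 (le_trans ux)//.
  rewrite ler_wpM2l ?(le_trans ler01)// ler_expR ler_wpM2l ?(ltW t1T)//.
  by rewrite mulr_ge0// ltW.
have := normr_ge0 (u x t1); move: `|u x t1| (A * _) => r B r0 rB.
have [r1|r1] := leP r 1; first by nra.
by nra.
Qed.

(** The speed is bounded, so the limit [L] exists; the speed converges to
[reduced_rhs L] and the mean value theorem turns this into a left derivative. *)
Lemma left_state : q <= 1 -> (exists x, x \in S) ->
  exists L : V -> R, forall x, x \in S -> forall e, 0 < e -> exists2 d, 0 < d &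
    forall s, s < T -> T - s < d ->
      `|L x - u x s - (T - s) * rhs L x| <= e * (T - s).
Proof.
move=> q1 Sne; have [K uK] := a_priori_bound q1 Sne.
have K0 : 0 <= K by have [x xS] := Sne; apply: le_trans (uK x 0 xS (lexx _) T0).
have [C rhsC] := rhs_bounded hw hmu hsigma hmusigma p1 q0 lambda0 K0.
have du x t : x \in S -> 0 < t -> t < T ->
    derivable (u x) t 1 /\ derive1 (u x) t = rhs (fun x => u x t) x.
  move=> xS t0 tT; have [d1 d2] := solution_rhs t0 tT xS.
  by rewrite derive1E.
have /choice[L LP] : forall x, exists l, x \in S ->
    forall s, 0 < s -> s < T -> `|l - u x s| <= C * (T - s).
  move=> x; have [xS|xS] := boolP (x \in S); last by exists 0.
  have [s t s0 st tT|l lP] := @lipschitz_left_limit _ (u x) 0 T C T0; last by exists l.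
  have := @mean_value_le _ (u x) 0 T 0 C _ _ s t s0 st tT.
  rewrite mulr0 subr0; apply=> r r0 rT; first by case: (du x r xS r0 rT).
  case: (du x r xS r0 rT) => _ ->; rewrite subr0; apply: rhsC => z zS.
  by apply: uK => //; exact: ltW.
exists L => x xS e e0.
have Lcvg z : z \in S -> u z t @[t --> T^'-] --> L z.
  move=> zS; apply/cvgrPdist_le => r r0.
  have rC : 0 < r / (`|C| + 1) by rewrite divr_gt0// ltr_wpDl.
  near=> t.
  have t0 : 0 < t by near: t; exact: nbhs_left_gt.
  have tT : t < T by near: t; exact: nbhs_left_lt.
  have : T - t < r / (`|C| + 1) by near: t; exact: nbhs_left_ltBl.
  rewrite ltr_pdivlMr ?ltr_wpDl// => tr.
  rewrite (le_trans (LP z zS t t0 tT))// (le_trans _ (ltW tr))// mulrC.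
  by rewrite ler_wpM2l ?subr_ge0 ?(ltW tT)// (le_trans (ler_norm _))// lerDl.
have rhs_cvg : rhs (fun x => u x t) x @[t --> T^'-] --> rhs L x.
  exact: (cvg_rhs hw hmu hsigma hmusigma p1 q0).
have [d /= d0 dP] : \forall t \near T^'-, `|rhs L x - rhs (fun x => u x t) x| <= e.
  by move/cvgrPdist_le: rhs_cvg; apply.
exists (Num.min d T) => [|s sT]; first by rewrite lt_min d0.
rewrite lt_min => /andP[sd sTT].
have s0 : 0 < s by lra.
have mv t : s <= t -> t < T ->
    `|u x t - u x s - (t - s) * rhs L x| <= e * (t - s).
  move=> st tT; apply: (@mean_value_le _ (u x) (Num.max 0 (T - d)) T) => //; last first.
  - by rewrite gt_max s0/=; lra.
  - move=> r; rewrite gt_max => /andP[r0 rd] rT; case: (du x r xS r0 rT) => _ ->.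
    by rewrite distrC; apply: dP => //=; rewrite ger0_norm ?subr_ge0 ?(ltW rT)//; lra.
  - by move=> r; rewrite gt_max => /andP[r0 rd] rT; case: (du x r xS r0 rT).
apply: (@ler_cvg_to _ (T^'-) _ _ (fun t => `|u x t - u x s - (t - s) * rhs L x|)
   (fun t => e * (t - s))).
- apply: cvg_norm; apply: cvgB; first by apply: cvgB; [exact: Lcvg|exact: cvg_cst].
  apply: cvgMr_tmp; apply: cvgB; last exact: cvg_cst.
  exact: cvg_at_left_filter cvg_id.
- apply: cvgMl_tmp; apply: cvgB; last exact: cvg_cst.
  exact: cvg_at_left_filter cvg_id.
- near=> t; apply: mv.
  + by near: t; exact: nbhs_left_ge.
  + by near: t; exact: nbhs_left_lt.
Unshelve. all: by end_near. Qed.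


(** Glue [u] on [S] with a solution of the reduced system issued from its limit
at [T], and let the boundary values be the balance points of the glued function
at all times; before [T] they are those of [u] by [solution_extend]. *)
Lemma continuation : q <= 1 -> p <= 2 -> (exists x, x \in S) ->
  exists T' v, [/\ T < T', solution_on adj S w p q lambda mu sigma u0 T'%:E v &
    forall x, x \in clos adj S -> forall t, 0 <= t -> t < T -> v x t = u x t].
Proof.
move=> q1 p2 Sne; have [L LP] := left_state q1 Sne.
have [k kE] : exists k, k = 1 + \sum_x `|L x| by eexists.
have k0 : 0 <= k by rewrite kE addr_ge0// sumr_ge0.
have [M rhsM] := rhs_bounded hw hmu hsigma hmusigma p1 q0 lambda0 k0.
(* Peano's theorem is applied to the field truncated outside the cube of radius
   [k].  During the time [dlt] its solution moves by less than [1], hence stays in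
   the cube, where the truncation has no effect. *)
pose clamp (a : R) := Num.max (- k) (Num.min k a).
have clampP a : [\/ a <= - k /\ clamp a = - k, - k <= a <= k /\ clamp a = a
    | k <= a /\ clamp a = k].
  rewrite /clamp; have [ka|ka] := leP k a.
    by apply: Or33; split=> //; apply/max_idPr; lra.
  by have [ak|ak] := leP (- k) a; [apply: Or32; rewrite (ltW ka)|apply: Or31; rewrite ltW].
have clamp_le a : `|clamp a| <= k.
  by rewrite ler_norml; case: (clampP a) => -[? ->]; apply/andP; split; lra.
have clamp_id a : `|a| <= k -> clamp a = a.
  by rewrite ler_norml => /andP[? ?]; case: (clampP a) => -[? ->]; lra.
have clamp_lip a b : `|clamp a - clamp b| <= `|a - b|.
  have := ler_norm (b - a); have := ler_norm (a - b); rewrite (distrC b a).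
  move: `|a - b| => r abr bar; rewrite ler_norml.
  by case: (clampP a) => -[? ->]; case: (clampP b) => -[? ->]; apply/andP; split; lra.
pose f y := rhs (fun x => clamp (y x)).
have fM y x : `|f y x| <= M by apply: rhsM => z _.
have M0 : 0 <= M by apply: le_trans (fM L (xchoose Sne)).
have [|Y [YL YP]] := @peano R V f M L fM.
  move=> Z y x Zy; apply: (cvg_rhs hw hmu hsigma hmusigma p1 q0) => z zS.
  apply/cvgrPdist_le => r r0; have /cvgrPdist_le/(_ r r0) := Zy z.
  by apply: filterS => n; apply: le_trans.
pose dlt := (M + 1)^-1.
have dlt0 : 0 < dlt by rewrite invr_gt0 ltr_wpDl.
have Yk s x : 0 <= s -> s < dlt -> `|Y s x| <= k.
  move=> s0 sd; rewrite -(subrK (L x) (Y s x)) (le_trans (ler_normD _ _))// kE lerD//.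
    rewrite (le_trans (YL s x))// ger0_norm//.
    have : s * (M + 1) <= 1 by rewrite -ler_pdivlMr ?ltr_wpDl// div1r ltW.
    by rewrite mulrDr mulr1 => /(le_trans _); apply; rewrite lerDl.
  by rewrite (bigD1 x)//= lerDl sumr_ge0.
have fY s x : 0 <= s -> s < dlt -> f (Y s) x = rhs (Y s) x.
  move=> s0 sd; rewrite /f; congr (_ x); apply: eq_rhs => z _; exact/clamp_id/Yk.
have Y0 : Y 0 = L.
  apply/funext => x; apply/eqP; rewrite -subr_eq0 -normr_le0.
  by rewrite (le_trans (YL 0 x))// normr0 mul0r.
pose W t x := if t < T then u x t else Y (t - T) x.
have Wu t : t < T -> W t = (fun x => u x t).
  by move=> tT; apply/funext => x; rewrite /W tT.
have WY t : T <= t -> W t = Y (t - T).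
  by move=> Tt; apply/funext => x; rewrite /W ltNge Tt.
have Wder x t : x \in S -> 0 < t -> t < T + dlt ->
    is_derive t 1 (fun r => W r x) (rhs (W t) x).
  move=> xS t0 tT'; have [tT|Tt] := ltP t T.
    rewrite (Wu _ tT); apply: (near_eq_is_derive (f := u x)); last first.
      exact: solution_rhs.
    by near=> r; rewrite Wu//; near: r; exact: lt_nbhsl.
  have tT0 : 0 <= t - T by rewrite subr_ge0.
  have tTd : t - T < dlt by rewrite ltrBlDl.
  apply: is_derive_sided => e e0.
    have [d d0 dP] := YP (t - T) x e tT0 e0.
    exists d => // s ts sd.
    rewrite !WY ?(le_trans Tt (ltW ts))// -fY//.
    have := dP (t - T) (s - T) tT0 (lexx _); rewrite lerB ?(ltW ts)//.
    have -> : s - T - (t - T) = s - t by ring.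
    by apply.
  move: Tt; rewrite le_eqVlt => /predU1P[Tt|Tt].
    have [d d0 dP] := LP x xS e e0.
    exists d => // s; rewrite -Tt WY// subrr Y0 => sT sd.
    by rewrite (Wu _ sT); exact: dP.
  have [d d0 dP] := YP (t - T) x e tT0 e0.
  exists (Num.min d (t - T)); first by rewrite lt_min d0 subr_gt0.
  move=> s st; rewrite lt_min => /andP[sd sT].
  have Ts : T <= s by lra.
  rewrite !WY ?(ltW Tt)// -fY//.
  have := dP (s - T) (t - T); rewrite subr_ge0 Ts lerB ?(ltW st)// lexx.
  have -> : t - T - (s - T) = t - s by ring.
  by apply.
pose D := [set t : R | 0 <= t /\ (t%:E < (T + dlt)%:E)%E].
have Wcont x t : x \in S -> D t -> W s x @[s --> within D (nbhs t)] --> W t x.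
  move=> xS [t0]; rewrite lte_fin => tT'.
  move: t0; rewrite le_eqVlt => /predU1P[<-|t0].
    have /subspace_continuousP/(_ 0) := solution_within_continuous (sub_clos adj xS).
    rewrite /= lexx T0 => /(_ isT) uc.
    rewrite (Wu _ T0); apply/cvgrPdist_le => r r0.
    move/cvgrPdist_le/(_ r r0): uc; rewrite !near_withinE.
    apply: filterS2 (lt_nbhsl T0) => s sT us [s0 _].
    by rewrite (Wu _ sT); apply: us; rewrite /= s0 sT.
  have [dW _] := Wder x t xS t0 tT'.
  have : W s x @[s --> t] --> W t x.
    by apply: differentiable_continuous; exact/derivable1_diffP.
  by apply: cvg_trans; apply: cvg_app; exact: cvg_within.
exists (T + dlt), (fun x t => extend (W t) x).
have agree x t : x \in clos adj S -> 0 <= t -> t < T -> extend (W t) x = u x t.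
  by move=> xS t0 tT; rewrite (Wu _ tT) -solution_extend.
split; [by rewrite ltrDl| |by move=> x xS t; exact: agree].
have extS x t : x \in S -> extend (W t) x = W t x by move=> xS; rewrite /bdry_extend xS.
split.
- move=> x xS; apply/subspace_continuousP => t Dt.
  by apply: (cvg_extend hw hmu hsigma hmusigma p1) => // z zS; exact: Wcont.
- move=> x /clos_cases[xS|xb] t t0; rewrite lte_fin => tT'.
    have -> : (fun r => extend (W r) x) = (fun r => W r x) by apply/funext => r; exact: extS.
    by have [] := Wder x t xS t0 tT'.
  rewrite /bdry_extend (negbTE (bdry_notin xb)).
  apply: balance_derivable => //; first exact: (@bdry_coef_admissible _ _ adj w).
  move=> z _; rewrite /inner; have [zS|zS] := boolP (z \in S); last exact: derivable_cst.
  by have [] := Wder z t zS t0 tT'.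
- move=> x xS t t0; rewrite lte_fin => tT'.
  have [_] := Wder x t xS t0 tT'.
  rewrite derive1E (_ : (fun r => extend (W r) x) = (fun r => W r x)); last first.
    by apply/funext => r; exact: extS.
  move=> ->; rewrite /reduced_rhs xS extS//; congr (_ + _).
  by rewrite /phi -mulrA; congr (_ * (_ `^ _ * _)); ring.
- by move=> z zb t _ _; exact: (@bdry_extend_boundary _ _ adj).
- by move=> x xS; rewrite agree// (solution_initial hu).
Unshelve. all: by end_near. Qed.

End Solution.

Theorem theorem3p10 (R : realType) (V : finType) (adj : rel V)
    (w : V -> V -> R) (S : {set V}) (p q lambda : R) (mu sigma u0 : V -> R)
    (hG : simple_graph adj) (hGc : connected_graph adj)
    (hw : is_weight adj w) (hS : connected_induced adj S)
    (hmu : forall z, z \in bdry adj S -> 0 <= mu z)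
    (hsigma : forall z, z \in bdry adj S -> 0 <= sigma z)
    (hmusigma : forall z, z \in bdry adj S -> 0 < mu z + sigma z)
    (hlambda : 0 < lambda)
    (hp : 0 < p - 1) (hpq : p - 1 <= q) (hq : q <= 1)
    (hsigma0 : exists2 z, z \in bdry adj S & sigma z != 0)
    (hu0 : forall x, x \in clos adj S -> 0 <= u0 x)
    (T : \bar R) (u : V -> R -> R)
    (hu : solution adj S w p q lambda mu sigma u0 T u) :
  T = +oo%E.
Proof.
have p1 : 1 < p by rewrite -subr_gt0.
have p2 : p <= 2 by lra.
have q0 : 0 < q by exact: lt_le_trans hp hpq.
have Sne : exists x, x \in S by case: hS.
case: hu; case: T => [r| |] // T0 sol maximal.
rewrite lte_fin in T0.
have [T' [v [rT' vsol vu]]] :=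
  continuation hw hmu hsigma hmusigma p1 q0 hlambda T0 sol hq p2 Sne.
have [] := maximal T'%:E v _ vsol; first by rewrite lte_fin.
by move=> x xS t t0; rewrite lte_fin; exact: vu.
Qed.
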